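(* Let $s,k,d \in \mathbb{Z}_{>0}$ with $\gcd(s,k)=1$ and $s \ge 2$, and let $b \ge 2$ and $0\le c<b$ be integers. For positive integers $S,K,D$, let $H_D(S,K)$ denote the maximum possible hook length of a cell in the Young diagram of an $(S,S+K)$-core with $D$-distinct parts. Let $\overline{s} = s \bmod k$ and $\widetilde{s} = \min \{\ell \cdot (\overline{s})^{-1} \bmod k \mid -d \leq \ell \leq d,\ \ell\neq0\}$, where $(\overline{s})^{-1}$ is the inverse of $\overline{s}$ modulo $k$. Then \[ H_{bd+c}(bs,bk)=\begin{cases} b\left(H_{d}(s,k)+2\right)-1 &\text{if } k=1 \text{ and } d<s,\\ b\left(H_{d}(s,k)+1\right)-1 &\text{if } k=1 \text{ and } d\geq s, \\ b\left(H_{d}(s,k)+2\right)-1 &\text{if } d < k \text{ and } \big(\overline{s}\widetilde{s}\bmod k = 1 \text{ or } d < \overline{s} \widetilde{s} \bmod k = k-1\big), \\ b\left(H_{d}(s,k)+1\right)-1 &\text{if } k > 1 \text{ and } \big(1 < \overline{s} \widetilde{s} \bmod k \le d \text{ or } d < \overline{s} \widetilde{s} \bmod k < k-1 \text{ or } d\geq k\big). \end{cases} \]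
   Context: A partition is a weakly decreasing tuple of positive integers $\lambda=(\lambda_1,\dots,\lambda_n)$; its Young diagram is the left-justified array with $\lambda_i$ cells in row $i$. The hook of a cell consists of the cell itself, all cells to its right in its row, and all cells below it in its column; the hook length is the number of cells in the hook. An $(S,T)$-core is a partition whose Young diagram has no cell of hook length $S$ or $T$. A partition is $D$-distinct (has $D$-distinct parts) if $\lambda_i-\lambda_{i+1}\ge D$ for all $i\in[n-1]$. Here $a \bmod b$ denotes the remainder of Euclidean division of $a$ by $b$. *)

(* Defs.v *)
From mathcomp Require Import all_boot all_order all_algebra.
From mathcomp Require Import zify.

Set Implicit Arguments.
Unset Strict Implicit.
Unset Printing Implicit Defensive.

Definition is_partition (la : seq nat) : bool :=
  sorted geq la && (0 \notin la).

(* Cells are pairs (row, column), both counted from 0. *)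
Definition young (la : seq nat) : seq (nat * nat) :=
  [seq (i, j) | i <- iota 0 (size la), j <- iota 0 (nth 0 la i)].

Definition in_hook (u v : nat * nat) : bool :=
  ((v.1 == u.1) && (u.2 <= v.2)) || ((v.2 == u.2) && (u.1 <= v.1)).

Definition hook_length (la : seq nat) (u : nat * nat) : nat :=
  count (in_hook u) (young la).

Definition is_core2 (S T : nat) (la : seq nat) : Prop :=
  is_partition la /\
  forall u, u \in young la -> hook_length la u <> S /\ hook_length la u <> T.

Definition distinct_parts (D : nat) (la : seq nat) : Prop :=
  forall i, i.+1 < size la -> nth 0 la i.+1 + D <= nth 0 la i.

Definition occurs_as_hook (D S K h : nat) : Prop :=
  exists (la : seq nat) (u : nat * nat),
    [/\ is_core2 S (S + K) la, distinct_parts D la,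
        u \in young la & hook_length la u = h].

(* [is_max_hook D S K h] says that the maximum H_D(S, K) exists and equals h. *)
Definition is_max_hook (D S K h : nat) : Prop :=
  occurs_as_hook D S K h /\
  forall h', occurs_as_hook D S K h' -> h' <= h.

(* The residue t in [0, k) with a * t = 1 modulo k; see [inv_modP]. *)
Definition inv_mod (a k : nat) : nat :=
  find (fun t => a * t == 1 %[mod k]) (iota 0 k).

(* The index i stands for l = i - d, so l runs over the nonzero integers in
   [-d, d]. All the residues are below k, so the default k is never the
   minimum; see [s_tildeP]. *)
Definition s_tilde (s k d : nat) : nat :=
  \big[minn/k]_(i < (2 * d).+1 | (i : nat) != d)
    absz (((i%:Z - d%:Z) * (inv_mod (s %% k) k)%:Z)%R %% k%:Z)%Z.

Lemma max_hook_unique D S K h1 h2 :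
  is_max_hook D S K h1 -> is_max_hook D S K h2 -> h1 = h2.
Proof.
move=> [o1 m1] [o2 m2]; apply/eqP.
by rewrite eqn_leq m2 // m1.
Qed.

Lemma inv_modP a k : 0 < k -> coprime a k ->
  inv_mod a k < k /\ a * inv_mod a k = 1 %[mod k].
Proof.
move=> k0 cak.
have hs : has (fun t => a * t == 1 %[mod k]) (iota 0 k).
  have [a0|a0] := posnP a.
    move: cak; rewrite a0 /coprime gcd0n => /eqP ->.
    by apply/hasP; exists 0; rewrite ?modn1.
  case: (egcdnP k a0) => u v e _; move: e; rewrite (eqP cak) => e.
  apply/hasP; exists (u %% k); first by rewrite mem_iota /= ltn_mod.
  by rewrite modnMmr mulnC e modnMDl.
have lt : inv_mod a k < k by rewrite -[X in _ < X](size_iota 0) -has_find.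
split=> //; have := nth_find 0 hs; rewrite -/(inv_mod a k) nth_iota //.
by move/eqP.
Qed.

Lemma s_tildeP (s k d : nat) : 0 < k -> 0 < d ->
  let r (l : int) := ((l * (inv_mod (s %% k) k)%:Z)%R %% k%:Z)%Z in
  (exists l : int, [/\ l != 0, - d%:Z <= l, l <= d%:Z
                     & r l = (s_tilde s k d)%:Z])%R /\
  (forall l : int, l != 0 -> - d%:Z <= l -> l <= d%:Z
                     -> (s_tilde s k d)%:Z <= r l)%R.
Proof.
move=> k0 d0 r.
have rb l : (0 <= r l < k%:Z)%R.
  by rewrite /r modz_ge0 ?ltz_pmod //; lia.
have le (l : int) : (l != 0 -> - d%:Z <= l -> l <= d%:Z ->
    (s_tilde s k d)%:Z <= r l)%R.
  move=> l0 l1 l2.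
  have hi : absz (l + d%:Z)%R < (2 * d).+1 by lia.
  have hn : (Ordinal hi : nat) != d by rewrite /=; lia.
  have : s_tilde s k d <= absz (r ((absz (l + d%:Z)%R)%:Z - d%:Z)%R).
    rewrite /s_tilde.
    have : Ordinal hi \in index_enum 'I_(2 * d).+1 by rewrite mem_index_enum.
    elim: (index_enum _) => // a e IH; rewrite inE big_cons.
    case/orP=> [/eqP <-|/IH H]; first by rewrite hn geq_minl.
    by case: ifP => // _; apply: leq_trans (geq_minr _ _) H.
  have -> : ((absz (l + d%:Z)%R)%:Z - d%:Z)%R = l by lia.
  by have := rb l; lia.
split=> //.
have : s_tilde s k d = k \/ exists l : int, [/\ l != 0, - d%:Z <= l, l <= d%:Z
      & r l = (s_tilde s k d)%:Z]%R.
  rewrite /s_tilde; elim/big_rec: _ => [|i x hi IH]; first by left.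
  rewrite /minn; case: ifP => _ //; right.
  exists (i%:Z - d%:Z)%R; have := ltn_ord i.
  by move=> li; split; [lia|lia|lia|have := rb (i%:Z - d%:Z)%R; rewrite /r; lia].
case=> // e; have := @le 1%R isT; have := rb 1%R; rewrite e; lia.
Qed.

(* Main.v *)
(** A partition is determined by its beta-set [X], the set of its first-column
    hook lengths, and its hook lengths are the [p - q] with [p] in [X] and
    [q < p] not in [X]. So the partition is an [(S, T)]-core iff [X] is closed
    under subtraction of [S] and of [T], and it has [D]-distinct parts iff the
    elements of [X] are pairwise more than [D] apart. Hence [h] is a
    first-column hook length of a [D]-distinct [(S, T)]-core iff it is
    admissible: [h] is not in the semigroup [<S, T>], and the elements of this
    semigroup up to [h] are pairwise more than [D] apart.

    Let [g] be the least element of [<s, s + k>] at distance at most [d] from a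
    smaller one [g']; by minimality [g'] is unique, and therefore [H_d(s, k)] is
    [g - 1] if [g' <> g - 1] and [g - 2] otherwise. Multiplying the semigroup
    by [b] turns [g' < g] into [b g' < b g], which are never consecutive, so
    that [H_{bd+c}(bs, bk) = b g - 1]. It remains to decide when [g - g' = 1].
    If [d < k], let [t] be [s_tilde] and [t s = u k + x] with [0 < x < k].
    Elements [m s + j k] at distance at most [d] have values of [m] at least
    [t] apart, whence [g = (u + t) s] and [g - g' = x] if [x <= d], and
    [g = (u + 1) (s + k)] and [g - g' = k - x] otherwise. *)

Require Import Defs.
From mathcomp Require Import all_boot all_order all_algebra.
From mathcomp Require Import zify.

Import GRing.Theory.

Set Implicit Arguments.
Unset Strict Implicit.
Unset Printing Implicit Defensive.

Lemma nth_sorted_geq la i j :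
  sorted geq la -> i <= j -> nth 0 la j <= nth 0 la i.
Proof.
move=> la_sorted ij; have [jn|nj] := ltnP j (size la); last first.
  by rewrite nth_default.
exact: sorted_leq_nth (rev_trans leq_trans) leqnn 0 _ la_sorted _ _
  (leq_ltn_trans ij jn) jn ij.
Qed.

Lemma nth_partition_gt0 la i : is_partition la -> i < size la -> 0 < nth 0 la i.
Proof.
case/andP=> _ la_n0 i_la; rewrite lt0n; apply: contra la_n0 => /eqP <-.
exact: mem_nth.
Qed.

Lemma mem_young la (i j : nat) :
  ((i, j) \in young la) = (i < size la) && (j < nth 0 la i).
Proof.
apply/allpairsPdep/andP => [[r [y [r_la y_row [-> ->]]]]|[i_la j_row]].
  by move: r_la y_row; rewrite !mem_iota.
by exists i, j; rewrite !mem_iota.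
Qed.

Definition column_length (la : seq nat) (j : nat) : nat := find (leq^~ j) la.

Lemma column_length_size la j : column_length la j <= size la.
Proof. exact: find_size. Qed.

Lemma ltn_column_length la i j :
  sorted geq la -> (i < column_length la j) = (j < nth 0 la i).
Proof.
move=> la_sorted; apply/idP/idP => [ic|].
  by rewrite ltnNge (before_find 0 ic).
apply: contraLR; rewrite -!leqNgt => ci.
have [i_la|la_i] := ltnP i (size la); last by rewrite nth_default.
have has_short : has (leq^~ j) la by rewrite has_find (leq_ltn_trans ci).
exact: leq_trans (nth_sorted_geq la_sorted ci) (nth_find 0 has_short).
Qed.

Lemma count_leq_iota j n : count (leq j) (iota 0 n) = n - j.
Proof. by elim: n => // n IHn; rewrite -addn1 iotaD count_cat IHn /=; lia. Qed.

Lemma count_hook_row la i j r : sorted geq la ->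
  count (in_hook (i, j)) [seq (r, y) | y <- iota 0 (nth 0 la r)] =
    if r == i then nth 0 la i - j else (i < r < column_length la j : nat).
Proof.
move=> la_sorted; rewrite count_map ltn_column_length //.
case: eqP => [->|/eqP r_i].
  rewrite -count_leq_iota; apply: eq_count => y.
  by rewrite /in_hook /= eqxx; lia.
have [ir|ri] := ltnP i r.
  rewrite (@eq_count _ _ (pred1 j)) => [|y]; last by rewrite /in_hook /=; lia.
  by rewrite count_uniq_mem ?iota_uniq // mem_iota.
rewrite (@eq_count _ _ pred0) ?count_pred0 // => y.
by rewrite /in_hook /=; lia.
Qed.

Lemma hook_lengthE la (i j : nat) : sorted geq la -> (i, j) \in young la ->
  hook_length la (i, j) = (nth 0 la i - j) + (column_length la j - i.+1).
Proof.
move=> la_sorted; rewrite mem_young => /andP[i_la j_row].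
have ic : i < column_length la j by rewrite ltn_column_length.
have cn := column_length_size la j.
rewrite /hook_length /young count_flatten -map_comp sumnE big_map.
under eq_bigr => r _ do rewrite /= count_hook_row //.
rewrite -[size la]subn0 -/(index_iota _ _) (big_cat_nat _ (ltnW i_la)) //=.
rewrite (big_ltn i_la) eqxx (big_cat_nat ic cn) /=.
rewrite big_nat big1 => [|r]; last by case: eqP; lia.
rewrite big_nat (eq_bigr (fun=> 1)) => [|r]; last by case: eqP; lia.
rewrite -big_nat sum_nat_const_nat muln1.
rewrite big_nat big1 => [|r]; last by case: eqP; lia.
by rewrite add0n addn0.
Qed.

Definition beta_number (la : seq nat) (i : nat) : nat :=
  nth 0 la i + (size la - i.+1).

Definition beta_set (la : seq nat) : seq nat :=
  mkseq (beta_number la) (size la).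

(* The beta-numbers label the vertical steps of the boundary path of the
   diagram, and these numbers label the horizontal ones. *)
Definition beta_gap (la : seq nat) (j : nat) : nat :=
  j + (size la - column_length la j).

Lemma beta_setP la x :
  reflect (exists2 i, i < size la & x = beta_number la i) (x \in beta_set la).
Proof.
apply: (iffP mapP) => -[i]; rewrite ?mem_iota => i_la ->.
  by exists i.
by exists i; rewrite ?mem_iota.
Qed.

Lemma hook_length_beta la (i j : nat) : sorted geq la -> (i, j) \in young la ->
  hook_length la (i, j) + beta_gap la j = beta_number la i.
Proof.
move=> la_sorted ij_la; rewrite hook_lengthE // /beta_number /beta_gap.
have := column_length_size la j; have := ltn_column_length i j la_sorted.
by move: ij_la; rewrite mem_young; lia.
Qed.

Lemma mem_young_beta la (i j : nat) : sorted geq la -> i < size la ->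
  ((i, j) \in young la) = (beta_gap la j < beta_number la i).
Proof.
move=> la_sorted i_la; rewrite mem_young i_la /beta_number /beta_gap.
have := column_length_size la j; have := ltn_column_length i j la_sorted.
by lia.
Qed.

Lemma beta_number_lt la i j : sorted geq la -> i < j -> j < size la ->
  beta_number la j < beta_number la i.
Proof.
move=> la_sorted ij j_la; rewrite /beta_number.
by have := nth_sorted_geq la_sorted (ltnW ij); lia.
Qed.

Lemma sorted_beta_set la : sorted geq la -> sorted geq (beta_set la).
Proof.
move=> la_sorted; apply/(sortedP 0) => i; rewrite size_mkseq => i_la.
by rewrite !nth_mkseq //= ?(ltnW i_la) // ltnW ?beta_number_lt.
Qed.

Lemma beta_gap_notin la j : sorted geq la -> beta_gap la j \notin beta_set la.
Proof.
move=> la_sorted; apply/beta_setP => -[i i_la]; rewrite /beta_number /beta_gap.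
have := column_length_size la j; have := ltn_column_length i j la_sorted.
by lia.
Qed.

Lemma column_length_unique la j c : sorted geq la -> c <= size la ->
    (forall i, i < size la -> (j < nth 0 la i) = (i < c)) ->
  column_length la j = c.
Proof.
move=> la_sorted c_la cP; have := column_length_size la j.
have [cl|cl|//] := ltngtP (column_length la j) c => col_la.
- by have := cP (column_length la j); rewrite -ltn_column_length //; lia.
- by have := cP c; rewrite -ltn_column_length //; lia.
Qed.

Lemma notin_beta_setP la y : is_partition la ->
  reflect (exists j, y = beta_gap la j) (y \notin beta_set la).
Proof.
move=> la_part; have /andP[la_sorted _] := la_part.
apply: (iffP idP) => [y_la|[j ->]]; last exact: beta_gap_notin.
pose n := size la; pose c := column_length (beta_set la) y.
have c_n : c <= n.
  by have := column_length_size (beta_set la) y; rewrite size_mkseq.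
have y_lt i : i < n -> (y < beta_number la i) = (i < c).
  move=> i_n; rewrite ltn_column_length ?sorted_beta_set //.
  by rewrite nth_mkseq.
have y_neq i : i < n -> y != beta_number la i.
  by move=> i_n; apply: contraNneq y_la => ->; apply/beta_setP; exists i.
have y_gt : c < n -> nth 0 la c + (n - c) <= y.
  move=> c_lt; have := y_lt c c_lt; have := y_neq c c_lt.
  by rewrite /beta_number; lia.
have c_y : n - c <= y by have [/y_gt|] := ltnP c n; lia.
exists (y - (n - c)).
rewrite /beta_gap (@column_length_unique _ _ c) //; first by lia.
move=> i i_n; have [ic|ci] := ltnP i c.
- have c1_n : c.-1 < n by lia.
  have := y_lt _ c1_n; have := @nth_sorted_geq la i c.-1 la_sorted.
  by rewrite /beta_number; lia.
- by have := nth_sorted_geq la_sorted ci; have := y_gt; lia.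
Qed.

Lemma beta_set_gt0 la x : is_partition la -> x \in beta_set la -> 0 < x.
Proof.
move=> la_part /beta_setP[i i_la ->].
by rewrite addn_gt0 nth_partition_gt0.
Qed.

Lemma row_hook_lengthP la i h : is_partition la -> i < size la ->
  (exists2 j : nat, (i, j) \in young la & hook_length la (i, j) = h) <->
  0 < h <= beta_number la i /\ beta_number la i - h \notin beta_set la.
Proof.
move=> la_part i_la; have /andP[la_sorted _] := la_part.
split=> [[j ij_la <-]|[h_bound /(notin_beta_setP _ la_part)[j jE]]].
- have := hook_length_beta la_sorted ij_la.
  move: ij_la; rewrite mem_young_beta // => gap_lt hE.
  split; first by lia.
  by rewrite -hE addKn beta_gap_notin.
- have ij_la : (i, j) \in young la by rewrite mem_young_beta //; lia.
  by exists j => //; have := hook_length_beta la_sorted ij_la; lia.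
Qed.

Lemma hook_length_leq_beta la u : is_partition la -> u \in young la ->
  exists2 x, x \in beta_set la & hook_length la u <= x.
Proof.
case: u => i j la_part ij_la; have := ij_la; rewrite mem_young => /andP[i_la _].
exists (beta_number la i); first by apply/beta_setP; exists i.
set h := hook_length la (i, j).
have [|/andP[_ //] _] := (row_hook_lengthP h la_part i_la).1.
by exists j.
Qed.

Lemma beta_set_hook_length la x : is_partition la -> x \in beta_set la ->
  exists2 u, u \in young la & hook_length la u = x.
Proof.
move=> la_part x_la; have x_gt0 := beta_set_gt0 la_part x_la.
have /beta_setP[i i_la xE] := x_la.
have [|j ij_la jE] := (row_hook_lengthP x la_part i_la).2; last first.
  by exists (i, j).
rewrite -xE x_gt0 leqnn subnn; split=> //.
by apply/negP => /(beta_set_gt0 la_part).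
Qed.

Lemma hook_length_neq_beta_closed la T : is_partition la ->
  (forall u, u \in young la -> hook_length la u <> T) <->
  (forall x, x \in beta_set la -> T <= x -> x - T \in beta_set la).
Proof.
move=> la_part; split=> [noT x|closedT [i j] ij_la hT].
- move/beta_setP=> [i i_la ->] T_le.
  have [->|T_gt0] := posnP T; first by rewrite subn0; apply/beta_setP; exists i.
  apply: contraT => gapT.
  have [|j ij_la /(noT _ ij_la)//] := (row_hook_lengthP T la_part i_la).2.
  by rewrite T_gt0.
- have := ij_la; rewrite mem_young => /andP[i_la _].
  have [|/andP[_ T_le]] := (row_hook_lengthP T la_part i_la).1.
    by exists j.
  by rewrite closedT //; apply/beta_setP; exists i.
Qed.

Definition separated (D : nat) (A : {pred nat}) : Prop :=
  {in A &, forall x y, y < x -> y + D < x}.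

Lemma distinct_parts_separated la D : sorted geq la ->
  distinct_parts D la <-> separated D (mem (beta_set la)).
Proof.
move=> la_sorted; split=> [la_distinct x y|la_sep i i_la].
- move=> /beta_setP[i i_la ->] /beta_setP[j j_la ->].
  have [ij|ji|->] := ltngtP i j; last by rewrite ltnn.
    have := la_distinct i; have := nth_sorted_geq la_sorted ij.
    by rewrite /beta_number; lia.
  by have := beta_number_lt la_sorted ji i_la; lia.
- have := la_sep (beta_number la i) (beta_number la i.+1).
  rewrite beta_number_lt // => /(_ _ _ isT).
  have beta_in j : j < size la -> beta_number la j \in beta_set la.
    by move=> j_la; apply/beta_setP; exists j.
  move=> /(_ (beta_in i (ltnW i_la)) (beta_in i.+1 i_la)).
  by rewrite /beta_number; lia.
Qed.

Lemma nth_sorted_gtn_addn X i j : sorted gtn X -> i <= j -> j < size X ->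
  nth 0 X j + (j - i) <= nth 0 X i.
Proof.
move=> X_sorted; elim: j => [|j IHj].
  by rewrite leqn0 => /eqP->; rewrite addn0.
rewrite leq_eqVlt => /orP[/eqP->|ij j_X]; first by rewrite subnn addn0.
have /(sortedP 0)/(_ _ j_X)/= := X_sorted.
by have := IHj ij (ltnW j_X); lia.
Qed.

Lemma partition_of_beta_set X : sorted gtn X -> 0 \notin X ->
  exists2 la, is_partition la & beta_set la = X.
Proof.
move=> X_sorted X_n0.
have X_gt i : i < size X -> size X - i.+1 < nth 0 X i.
  move=> i_X; have last_X : (size X).-1 < size X by lia.
  have : nth 0 X (size X).-1 != 0.
    by apply: contraNneq X_n0 => <-; apply: mem_nth.
  by have := @nth_sorted_gtn_addn X i (size X).-1 X_sorted; lia.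
pose la := mkseq (fun i => nth 0 X i - (size X - i.+1)) (size X).
exists la.
- apply/andP; split.
    apply/(sortedP 0) => i; rewrite size_mkseq => i_X.
    rewrite !nth_mkseq //= ?(ltnW i_X) //.
    by have /(sortedP 0)/(_ _ i_X)/= := X_sorted; lia.
  apply/mapP => -[i]; rewrite mem_iota => i_X.
  by have := X_gt i; lia.
- apply: (@eq_from_nth _ 0) => [|i]; rewrite !size_mkseq // => i_X.
  rewrite nth_mkseq ?size_mkseq // /beta_number nth_mkseq // size_mkseq.
  by rewrite subnK // ltnW ?X_gt.
Qed.

Definition semigroup (s t : nat) : {pred nat} :=
  fun g => [exists m : 'I_g.+1, (m * s <= g) && (t %| g - m * s)].

Lemma semigroupP s t g :
  reflect (exists m n, g = m * s + n * t) (g \in semigroup s t).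
Proof.
apply: (iffP existsP) => [[m /andP[m_le /dvdnP[n nE]]]|[m [n ->]]].
  by exists m, n; rewrite -nE subnKC.
have [->|s_gt0] := posnP s.
  by exists ord0; rewrite mul0n subn0 muln0 add0n dvdn_mull.
have m_lt : m < (m * s + n * t).+1.
  by rewrite ltnS (leq_trans (leq_pmulr m s_gt0)) ?leq_addr.
by exists (Ordinal m_lt); rewrite /= leq_addr addKn dvdn_mull.
Qed.

Lemma semigroup_addP s k g :
  reflect (exists m j, j <= m /\ g = m * s + j * k) (g \in semigroup s (s + k)).
Proof.
apply: (iffP (semigroupP s (s + k) g)) => -[m [n]] => [->|[nm ->]].
  by exists (m + n), n; rewrite leq_addl mulnDl mulnDr addnA.
by exists (m - n), n; rewrite mulnDr addnA -mulnDl subnK.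
Qed.

Lemma semigroup0 s t : 0 \in semigroup s t.
Proof. by apply/semigroupP; exists 0, 0. Qed.

Lemma semigroupDl s t g : g \in semigroup s t -> g + s \in semigroup s t.
Proof.
case/semigroupP=> m [n ->]; apply/semigroupP; exists m.+1, n.
by rewrite mulSn addnC addnA.
Qed.

Lemma semigroupDr s t g : g \in semigroup s t -> g + t \in semigroup s t.
Proof.
case/semigroupP=> m [n ->]; apply/semigroupP; exists m, n.+1.
by rewrite mulSn addnCA addnC.
Qed.

Lemma semigroup_geq s t g : s <= t -> g \in semigroup s t -> 0 < g -> s <= g.
Proof. by move=> st /semigroupP[[|m] [[|n] ->]] //; rewrite !mulSn; lia. Qed.

Lemma mem_semigroupM b s t g :
  0 < b -> (b * g \in semigroup (b * s) (b * t)) = (g \in semigroup s t).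
Proof.
move=> b_gt0; apply/semigroupP/semigroupP => -[m [n gE]]; exists m, n.
  by apply/eqP; rewrite -(eqn_pmul2l b_gt0) gE mulnDr !(mulnCA b).
by rewrite gE mulnDr !(mulnCA b).
Qed.

Lemma dvdn_semigroupM b s t g : g \in semigroup (b * s) (b * t) -> b %| g.
Proof.
by case/semigroupP=> m [n ->]; rewrite dvdn_add // dvdn_mull // dvdn_mulr.
Qed.

Lemma subn_semigroup_closed (A : {pred nat}) s t :
    {in A, forall x, s <= x -> x - s \in A} ->
    {in A, forall x, t <= x -> x - t \in A} ->
  {in A, forall x g, g \in semigroup s t -> g <= x -> x - g \in A}.
Proof.
move=> A_s A_t x Ax _ /semigroupP[m [n ->]].
elim: m n => [|m IHm] n; last first.
  rewrite mulSn -addnA => le_x.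
  by rewrite [s + _]addnC subnDA; apply: A_s; [apply: IHm|]; lia.
elim: n => [|n IHn]; first by rewrite subn0.
rewrite mul0n add0n mulSn => le_x.
by rewrite [t + _]addnC subnDA; apply: A_t; [apply: IHn|]; lia.
Qed.

Definition admissible (D S T h : nat) : Prop :=
  h \notin semigroup S T /\ separated D [pred g in semigroup S T | g <= h].

Lemma beta_set_admissible D S T la h : is_core2 S T la -> distinct_parts D la ->
  h \in beta_set la -> admissible D S T h.
Proof.
move=> [la_part la_core] la_distinct h_la; have /andP[la_sorted _] := la_part.
have h_sub : forall g, g \in semigroup S T -> g <= h -> h - g \in beta_set la.
  apply: (subn_semigroup_closed _ _ h_la).
  - by apply/hook_length_neq_beta_closed => // u /la_core[].
  - by apply/hook_length_neq_beta_closed => // u /la_core[].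
split=> [|g g' /andP[gG gh] /andP[g'G g'h] lt_g].
  apply/negP => hG.
  by have := beta_set_gt0 la_part (h_sub h hG (leqnn h)); rewrite subnn.
have /(distinct_parts_separated _ la_sorted) la_sep := la_distinct.
have := la_sep _ _ (h_sub g' g'G g'h) (h_sub g gG gh).
by move: gh g'h => /=; lia.
Qed.

Lemma admissible_beta_set D S T h : admissible D S T h ->
  exists la, [/\ is_core2 S T la, distinct_parts D la & h \in beta_set la].
Proof.
move=> [h_notin h_sep].
pose X := [seq y <- rev (iota 0 h.+1) | h - y \in semigroup S T].
have memX y : (y \in X) = (y <= h) && (h - y \in semigroup S T).
  by rewrite mem_filter mem_rev mem_iota andbC.
have X_sorted : sorted gtn X.
  apply: sorted_filter; first exact: rev_trans ltn_trans.
  by rewrite rev_sorted iota_ltn_sorted.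
have [|la la_part laX] := partition_of_beta_set X_sorted.
  by rewrite memX subn0 leq0n.
have X_closed R : (forall g, g \in semigroup S T -> g + R \in semigroup S T) ->
    forall u, u \in young la -> hook_length la u <> R.
  move=> addR; apply/hook_length_neq_beta_closed => //.
  move=> x; rewrite laX !memX => /andP[xh hxG] Rx.
  rewrite (_ : h - (x - R) = h - x + R); last by lia.
  by rewrite addR // andbT; lia.
exists la; split; last by rewrite laX memX leqnn subnn semigroup0.
- split=> // u u_la; split.
  + by apply: X_closed u_la => g; apply: semigroupDl.
  + by apply: X_closed u_la => g; apply: semigroupDr.
- have /andP[la_sorted _] := la_part.
  apply/distinct_parts_separated => // x y; rewrite laX !memX.
  move=> /andP[xh hxG] /andP[yh hyG] yx.
  have := h_sep (h - y) (h - x); rewrite !inE hxG hyG !leq_subr => /(_ isT isT).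
  by lia.
Qed.

Lemma occurs_as_hook_leq_admissible D S K h : occurs_as_hook D S K h ->
  exists2 h', h <= h' & admissible D S (S + K) h'.
Proof.
move=> [la [u [la_core la_distinct u_la <-]]]; have [la_part _] := la_core.
have [x x_la hook_x] := hook_length_leq_beta la_part u_la.
by exists x => //; apply: beta_set_admissible x_la.
Qed.

Lemma admissible_occurs_as_hook D S K h :
  admissible D S (S + K) h -> occurs_as_hook D S K h.
Proof.
move=> /admissible_beta_set[la [la_core la_distinct h_la]].
have [la_part _] := la_core.
have [u u_la hook_u] := beta_set_hook_length la_part h_la.
by exists la, u.
Qed.

Definition first_gap (d s t g' g : nat) : Prop :=
  [/\ g' \in semigroup s t, g \in semigroup s t, g' < g <= g' + d &
      {in semigroup s t &, forall e' e, e' < e <= e' + d -> g <= e}].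

Lemma admissible_first_gap d s t g' g h : first_gap d s t g' g ->
  admissible d s t h <-> h \notin semigroup s t /\ h < g.
Proof.
case=> g'G gG /andP[lt_g le_g] g_min; split=> -[h_notin h_bound]; split=> //.
  rewrite ltnNge; apply/negP => g_h.
  have := h_bound g g'; rewrite !inE g'G gG g_h (leq_trans (ltnW lt_g) g_h).
  by move=> /(_ isT isT lt_g); rewrite ltnNge le_g.
move=> e e' /andP[eG /= e_h] /andP[e'G _] lt_e.
rewrite ltnNge; apply/negP => le_e.
have := g_min e' e e'G eG; rewrite lt_e le_e => /(_ isT) g_e.
by have := leq_ltn_trans (leq_trans g_e e_h) h_bound; rewrite ltnn.
Qed.

Lemma first_gapM b c d s t g' g : c < b -> first_gap d s t g' g ->
  first_gap (b * d + c) (b * s) (b * t) (b * g') (b * g).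
Proof.
move=> c_b [g'G gG /andP[lt_g le_g] g_min]; have b_gt0 : 0 < b by lia.
split; rewrite ?mem_semigroupM //.
  rewrite ltn_pmul2l // lt_g (leq_trans (_ : _ <= b * (g' + d))) ?leq_pmul2l //.
  by rewrite mulnDr addnA leq_addr.
move=> x y xG yG.
have [/dvdnP[e' xE] /dvdnP[e yE]] := (dvdn_semigroupM xG, dvdn_semigroupM yG).
move: xG yG; rewrite {}xE {}yE ![_ * b]mulnC !mem_semigroupM // => e'G eG.
rewrite ltn_pmul2l // leq_pmul2l // => /andP[lt_e le_e].
apply: (g_min e' e) => //; rewrite lt_e -ltnS -(ltn_pmul2l b_gt0).
by rewrite (leq_ltn_trans le_e) // mulnS mulnDr; lia.
Qed.

(* By minimality of [g] no semigroup element other than [g'] lies in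
   [[g' - d, g - 1]], so [g - 1] is admissible unless it equals [g'], in which
   case [g - 2] is. *)
Lemma max_hook_first_gap d S K g' g : 1 < S -> first_gap d S (S + K) g' g ->
  is_max_hook d S K (g - 1 - (g == g'.+1)).
Proof.
move=> S_gt1 gap; have [g'G gG /andP[lt_g le_g] g_min] := gap.
have S_g : S <= g by apply: (@semigroup_geq S (S + K)) => //; lia.
set h := g - 1 - _.
have h_adm : admissible d S (S + K) h.
  apply/(admissible_first_gap _ gap); split; last by rewrite /h; lia.
  apply/negP => hG; have := g_min h g' hG g'G; have := g_min g' h g'G hG.
  by rewrite /h; case: eqP; lia.
split=> [|h' /occurs_as_hook_leq_admissible[x h'_x]].
  exact: admissible_occurs_as_hook.
move=> /(admissible_first_gap _ gap)[x_notin x_g]; apply: leq_trans h'_x _.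
have x_g' : x != g' by apply: contraNneq x_notin => ->.
by rewrite /h; case: eqP; lia.
Qed.

Lemma max_hookM d S K b c g' g : 0 < S -> 1 < b -> c < b ->
    first_gap d S (S + K) g' g ->
  is_max_hook (b * d + c) (b * S) (b * K) (b * g - 1).
Proof.
move=> S_gt0 b_gt1 c_b /(first_gapM c_b); rewrite mulnDr => gapM.
have := max_hook_first_gap (leq_trans b_gt1 (leq_pmulr b S_gt0)) gapM.
have /negPf-> : b * g != (b * g').+1.
  apply/eqP => /(congr1 (modn^~ b)).
  by rewrite modnMr -addn1 mulnC modnMDl modn_small.
by rewrite subn0.
Qed.

Lemma first_gap_0_generator d s t :
  0 < s <= d -> s <= t -> first_gap d s t 0 s.
Proof.
move=> /andP[s_gt0 sd] st; split; rewrite ?semigroup0 ?add0n ?s_gt0 //.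
  by apply/semigroupP; exists 1, 0; lia.
by move=> e' e _ eG /andP[lt_e _]; apply: semigroup_geq eG _; lia.
Qed.

Lemma semigroup_add_small s k g : g \in semigroup s (s + k) ->
  [\/ g = 0, g = s, g = s + k | s + s <= g].
Proof.
case/semigroup_addP=> -[|[|m]] [j [jm ->]].
- by constructor 1; lia.
- by case: j jm => [|[|]] // _; [constructor 2|constructor 3]; lia.
- by constructor 4; rewrite !mulSn; lia.
Qed.

Lemma first_gap_generators d s k : 0 < k <= d -> d < s ->
  first_gap d s (s + k) s (s + k).
Proof.
move=> /andP[k_gt0 kd] ds; split.
- by apply/semigroupP; exists 1, 0; lia.
- by apply/semigroupP; exists 0, 1; lia.
- by lia.
- by move=> e' e /semigroup_add_small[] e'E /semigroup_add_small[] eE; lia.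
Qed.

Definition near_multiple (d k n : nat) : bool :=
  (0 < n %% k <= d) || (k <= n %% k + d).

Lemma near_multipleP (d k n : nat) : d < k ->
  reflect (exists l : int, [/\ l != 0, - d%:Z <= l, l <= d%:Z
                             & (n = l %[mod k])%Z])%R
          (near_multiple d k n).
Proof.
move=> dk; have r_lt : n %% k < k by rewrite ltn_mod; lia.
rewrite /near_multiple; apply: (iffP idP) => [/orP[r_low|r_high]|].
- by exists (n %% k); split; rewrite ?modz_nat ?modn_mod //; lia.
- exists ((n %% k)%:Z - k%:Z)%R.
  split; [lia..|].
  by rewrite [(_ - _)%R]addrC -mulN1r modzMDl !modz_nat modn_mod.
- move=> [l [l_neq0 l_ge l_le]]; rewrite modz_nat => nE.
  have [l_gt0|l_lt0] : (0 < l \/ l < 0)%R by lia.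
    by rewrite modz_small in nE; lia.
  by rewrite -(modzMDl 1) mul1r modz_small in nE; lia.
Qed.

Lemma mulz_inv_mod s k : 0 < k -> coprime s k ->
  ((s%:Z * (inv_mod (s %% k) k)%:Z)%R = 1 %[mod k])%Z.
Proof.
move=> k_gt0 co_sk; have [|_ invE] := @inv_modP (s %% k) k k_gt0.
  by rewrite coprime_modl.
by rewrite -PoszM !modz_nat -modnMml invE.
Qed.

Lemma near_multiple_s_tilde s k d : 0 < d < k -> coprime s k ->
  near_multiple d k (s_tilde s k d * s).
Proof.
move=> /andP[d_gt0 dk] co_sk; have k_gt0 : 0 < k by lia.
apply/near_multipleP => //.
have [[l [l_neq0 l_ge l_le lE]] _] := s_tildeP s k_gt0 d_gt0.
exists l; split=> //.
rewrite PoszM -lE modzMml -mulrA [(_ * Posz s)%R]mulrC.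
by rewrite -modzMmr mulz_inv_mod // modzMmr mulr1.
Qed.

Lemma s_tilde_min s k d m : 0 < d < k -> coprime s k ->
  near_multiple d k (m * s) -> s_tilde s k d <= m.
Proof.
move=> /andP[d_gt0 dk] co_sk /(near_multipleP _ dk)[l [l_neq0 l_ge l_le lE]].
have k_gt0 : 0 < k by lia.
have [_ /(_ l l_neq0 l_ge l_le)] := s_tildeP s k_gt0 d_gt0.
rewrite -modzMml -lE modzMml PoszM -mulrA -modzMmr mulz_inv_mod //.
by rewrite modzMmr mulr1 modz_nat lez_nat => /leq_trans; apply; apply: leq_mod.
Qed.

(* With [v := m * s %/ k], these are the larger elements of two close pairs:
   [v * (s + k)] and [(v + m) * s], respectively [(v + 1 + m) * s] and
   [(v + 1) * (s + k)]. *)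
Definition low_top (s k m : nat) : nat := (m * s %/ k + m) * s.

Definition high_top (s k m : nat) : nat := (m * s %/ k).+1 * (s + k).

Lemma low_topE s k m : low_top s k m = m * s %/ k * (s + k) + m * s %% k.
Proof. by rewrite /low_top mulnDl {2}(divn_eq (m * s) k) mulnDr addnA. Qed.

Lemma high_topE s k m :
  high_top s k m + m * s %% k = (m * s %/ k + m).+1 * s + k.
Proof.
by have := low_topE s k m; rewrite /low_top /high_top !mulSn; lia.
Qed.

Lemma leq_low_top s k : {homo low_top s k : m n / m <= n}.
Proof.
by move=> m n mn; rewrite leq_mul // leq_add // leq_div2r // leq_mul.
Qed.

Lemma leq_high_top s k : {homo high_top s k : m n / m <= n}.
Proof. by move=> m n mn; rewrite leq_mul // ltnS leq_div2r // leq_mul. Qed.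

(* Here [m] is the difference of the coefficients of [s] in [g] and [g'], when
   these are written as combinations of [s] and [k]. *)
Lemma semigroup_close_pair s k g' g :
    g' \in semigroup s (s + k) -> g \in semigroup s (s + k) ->
    g' < g < g' + k ->
  exists m, m * s %% k = g - g' /\ low_top s k m <= g \/
            m * s %% k = k - (g - g') /\ high_top s k m <= g.
Proof.
move=> /semigroup_addP[m' [j' [jm' g'E]]] /semigroup_addP[m [j [jm gE]]].
move=> /andP[lt_g g_lt].
have k_gt0 : 0 < k by lia.
have [mm|mm|mm] := ltngtP m' m.
- have addE : (m - m') * s + j * k = j' * k + (g - g') by nia.
  have jj : j <= j' by nia.
  have sE : (m - m') * s = (j' - j) * k + (g - g') by nia.
  exists (m - m'); left; rewrite /low_top sE divnMDl // modnMDl.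
  rewrite divn_small ?modn_small; [|lia..].
  by split=> //; nia.
- have addE : (m' - m) * s + j' * k + (g - g') = j * k by nia.
  have jj : j' < j by nia.
  have sE : (m' - m) * s = (j - j').-1 * k + (k - (g - g')) by nia.
  exists (m' - m); right; rewrite /high_top sE divnMDl // modnMDl.
  rewrite divn_small ?modn_small; [|lia..].
  by split=> //; nia.
- by have [jj|jj] := leqP j j'; nia.
Qed.

Section LeastNearMultiple.

Variables s k d t : nat.
Hypothesis dk : d < k.
Hypothesis t_near : near_multiple d k (t * s).
Hypothesis t_min : forall m, near_multiple d k (m * s) -> t <= m.

Let x := t * s %% k.

Let x_lt : x < k. Proof. by rewrite ltn_mod; lia. Qed.

Lemma semigroup_gap_tops g' g :
    g' \in semigroup s (s + k) -> g \in semigroup s (s + k) ->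
    g' < g <= g' + d ->
  (exists m, [/\ t <= m, m * s %% k <= d & low_top s k m <= g]) \/
  high_top s k t <= g.
Proof.
move=> g'G gG gap; have [|m m_top] := semigroup_close_pair g'G gG; first by lia.
have tm : t <= m by apply: t_min; rewrite /near_multiple; lia.
case: m_top => -[mE top_g]; [left; exists m; split=> //; lia | right].
exact: leq_trans (leq_high_top s k tm) top_g.
Qed.

Lemma first_gap_low_top : x <= d ->
  first_gap d s (s + k) (t * s %/ k * (s + k)) (low_top s k t).
Proof.
move=> xd; have x_gt0 : 0 < x by move: t_near; rewrite /near_multiple -/x; lia.
split.
- by apply/semigroupP; exists 0, (t * s %/ k).
- by apply/semigroupP; exists (t * s %/ k + t), 0; rewrite addn0.
- by rewrite low_topE -/x; lia.
- move=> e' e e'G eG /(semigroup_gap_tops e'G eG).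
  case=> [[m [tm _]]|]; apply: leq_trans.
    exact: leq_low_top.
  by rewrite low_topE /high_top mulSn -/x; lia.
Qed.

Hypothesis s_gt0 : 0 < s.

Let d_lt_s : d < x -> d < s.
Proof.
move=> dx; rewrite ltnNge; apply/negP => sd.
have t_le1 : t <= 1.
  by apply: t_min; rewrite /near_multiple mul1n modn_small; lia.
have x_s : x <= s.
  by rewrite (leq_trans (leq_mod _ _)) // -[leqRHS]mul1n leq_mul.
by have := leq_trans dx (leq_trans x_s sd); rewrite ltnn.
Qed.

Lemma high_top_leq_low_topS : d < x -> high_top s k t <= low_top s k t.+1.
Proof.
move=> dx; have ds := d_lt_s dx.
have kx : k <= x + d by move: t_near; rewrite /near_multiple -/x; lia.
have quo_lt : t * s %/ k < t.+1 * s %/ k.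
  rewrite leq_divRL ?(leq_ltn_trans _ dk) //.
  by have := divn_eq (t * s) k; rewrite -/x !mulSn; lia.
have low_geq : (t * s %/ k + t).+2 * s <= low_top s k t.+1.
  by rewrite leq_mul2r; lia.
by have := high_topE s k t; rewrite -/x; move: low_geq; rewrite !mulSn; lia.
Qed.

Lemma first_gap_high_top : d < x ->
  first_gap d s (s + k) ((t * s %/ k + t).+1 * s) (high_top s k t).
Proof.
move=> dx.
have kx : k <= x + d by move: t_near; rewrite /near_multiple -/x; lia.
split.
- by apply/semigroupP; exists (t * s %/ k + t).+1, 0; rewrite addn0.
- by apply/semigroupP; exists 0, (t * s %/ k).+1.
- by have := high_topE s k t; rewrite -/x; lia.
- move=> e' e e'G eG /(semigroup_gap_tops e'G eG).
  case=> [[m [tm md]]|//]; apply: leq_trans.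
  have t_lt : t < m.
    rewrite ltn_neqAle tm andbT; apply: contraTneq dx => tE.
    by rewrite -leqNgt /x tE.
  exact: leq_trans (high_top_leq_low_topS dx) (leq_low_top s k t_lt).
Qed.

End LeastNearMultiple.

Lemma exists_first_gap s k d : 0 < s -> 0 < k -> 0 < d -> coprime s k ->
  let x := (s %% k * s_tilde s k d) %% k in
  exists g' g, first_gap d s (s + k) g' g /\
    g - g' = if k <= d then if s <= d then s else k
             else if x <= d then x else k - x.
Proof.
move=> s_gt0 k_gt0 d_gt0 co_sk x; have [kd|dk] := leqP k d.
  have [sd|ds] := leqP s d.
    exists 0, s; rewrite subn0; split=> //.
    by apply: first_gap_0_generator; lia.
  exists s, (s + k); rewrite addKn; split=> //.
  by apply: first_gap_generators; lia.
have d_bounds : 0 < d < k by rewrite d_gt0.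
have t_near := near_multiple_s_tilde d_bounds co_sk.
have t_min := s_tilde_min d_bounds co_sk.
set t := s_tilde s k d in x t_near t_min *.
have -> : x = t * s %% k by rewrite /x modnMml mulnC.
have x_lt : t * s %% k < k by rewrite ltn_mod.
have [xd|dx] := leqP (t * s %% k) d.
- exists (t * s %/ k * (s + k)), (low_top s k t).
  by rewrite {2}low_topE addKn; split=> //; apply: first_gap_low_top.
- exists ((t * s %/ k + t).+1 * s), (high_top s k t).
  split; first exact: first_gap_high_top.
  by have := high_topE s k t; lia.
Qed.

Theorem theorem1p2 (s k d b c : nat) :
  2 <= s -> 0 < k -> 0 < d -> coprime s k -> 2 <= b -> c < b ->
  let x := ((s %% k) * s_tilde s k d) %% k in
  exists H Hb : nat,
    [/\ is_max_hook d s k H,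
        is_max_hook (b * d + c) (b * s) (b * k) Hb
      & [/\ k = 1 /\ d < s -> Hb = b * (H + 2) - 1,
            k = 1 /\ s <= d -> Hb = b * (H + 1) - 1,
            d < k /\ (x = 1 \/ (d < x /\ x = k - 1)) -> Hb = b * (H + 2) - 1
          & 1 < k /\ ((1 < x /\ x <= d) \/ (d < x /\ x < k - 1) \/ k <= d) ->
              Hb = b * (H + 1) - 1]].
Proof.
move=> s_gt1 k_gt0 d_gt0 co_sk b_gt1 c_b x; have s_gt0 := ltnW s_gt1.
have [g' [g [gap]]] := exists_first_gap s_gt0 k_gt0 d_gt0 co_sk.
rewrite -/x => gapE.
have x_lt : x < k by rewrite ltn_mod.
have [_ gG /andP[lt_g _] _] := gap.
have s_g : s <= g by apply: semigroup_geq gG _; lia.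
exists (g - 1 - (g == g'.+1)), (b * g - 1); split.
- exact: max_hook_first_gap gap.
- exact: max_hookM gap.
- have [g_succ|g_far] := eqVneq g g'.+1.
    rewrite (_ : g - 1 - true + 2 = g); last by lia.
    by move: gapE; do 2!case: ifP => ?; split; lia.
  rewrite subn0 subnK; last by lia.
  by move: gapE; do 2!case: ifP => ?; split; lia.
Qed.
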